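(* Let $\lambda\in(0,1)$ and $\Lambda=1-2\lambda^2$. A nonconstant meromorphic solution $\nabla$ of the differential equation $\big[\tfrac98(\nabla')^2+\Lambda(\nabla-1)\big]^2=\nabla(\nabla-1)^2(4\nabla-3)^2$ can have no zeros.
   Context: Here $\nabla$ denotes an unknown meromorphic function of a complex variable (on a connected open subset of $\mathbb{C}$), not an operator; $\nabla'$ is its derivative. *)

(* Defs.v *)
(* Complex numbers: C := complex R = R[i] for R : realType,
   viewed as a normed space over itself, so 'D_1 f z is the complex derivative. *)
From HB Require Import structures.
From mathcomp Require Import all_boot all_order all_algebra.
From mathcomp Require Import complex.
From mathcomp Require Import all_classical all_reals all_analysis.
Set Implicit Arguments. Unset Strict Implicit. Unset Printing Implicit Defensive.
Import Order.TTheory GRing.Theory Num.Theory ComplexField.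
Import numFieldNormedType.Exports.
Local Open Scope classical_set_scope.
Local Open Scope ring_scope.

(* f : C -> C is meromorphic on the open set D with pole set P:
   - P is contained in D and has no accumulation point in D (P is discrete and
     closed in D);
   - f is complex differentiable at every point of D \ P;
   - at every point p of P, |f z| -> +oo as z -> p (z <> p).
   The values of f at the points of P are irrelevant. *)
Definition meromorphic_on (R : realType) (D P : set R[i]^o) (f : R[i]^o -> R[i]^o) : Prop :=
  [/\ P `<=` D,
      (forall z, D z -> \forall w \near z^', ~ P w),
      (forall z, D z -> ~ P z -> derivable f z 1) &
      (forall p, P p -> forall M : R, \forall w \near p^', (M%:C)%C <= `|f w|)].

(* Main.v *)
(* Put k(y) = y (y - 1)^2 (4 y - 3)^2 and g = 9/8 f'^2 + L (f - 1), so that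
   g^2 = k(f).  No Cauchy theory is used: f' is only known to exist.  Since f'
   solves a quartic equation with continuous coefficients and derivatives have
   the Darboux property, f' is continuous, and then g is differentiable wherever
   f is small and nonzero, as a continuous square root of k(f).

   Let f vanish at z0.  If L != 0 then f'(z0) != 0, so f ~ f'(z0) (z - z0) and g
   is a square root of k(f) ~ 9 f: along a small circle around z0, g'/g is close
   to (1/2) / (z - z0), which is impossible for a single-valued g.

   If L = 0, then u = f / f' is differentiable where f is small and nonzero, with
   u' close to 3/4.  For z1 near z0 with f(z1) != 0, put c = z1 - (4/3) u(z1).
   Along the circle through z1 with center c, u stays close to (3/4) (z - c), so
   f'/f = 1/u is close to (4/3) / (z - c), again impossible.  Hence f vanishes
   near z0, the zero set of f is open and closed in D, and f is constant. *)

Require Import Defs.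
From HB Require Import structures.
From mathcomp Require Import all_boot all_order all_algebra.
From mathcomp Require Import complex.
From mathcomp Require Import all_classical all_reals all_analysis.
From mathcomp Require Import ring lra.
Import Order.TTheory GRing.Theory Num.Theory ComplexField.
Import numFieldNormedType.Exports.
Local Open Scope classical_set_scope.
Local Open Scope ring_scope.

Set Implicit Arguments.
Unset Strict Implicit.
Unset Printing Implicit Defensive.

(** * The real-valued modulus and continuity of complex-valued maps *)

Section basics.
Variable R : realType.
Local Notation C := (R[i]^o).

(* The norm of [R[i]] takes its values in [R[i]] itself; [N] is the same number
   seen in [R], where [lra] applies. *)
Definition N (x : C) : R := Normc.normc x.

Lemma normE (x : C) : `|x| = (N x)%:C%C.
Proof. by []. Qed.

Lemma N_ge0 (x : C) : 0 <= N x.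
Proof. by rewrite -(@lecR R) -normE normr_ge0. Qed.

Lemma N0 : N 0 = 0.
Proof. exact: Normc.normc0. Qed.

Lemma N1 : N 1 = 1.
Proof. exact: Normc.normc1. Qed.

Lemma N_eq0 (x : C) : (N x == 0) = (x == 0).
Proof. by apply/eqP/eqP => [/Normc.eq0_normc//|->]; rewrite N0. Qed.

Lemma N_gt0 (x : C) : (0 < N x) = (x != 0).
Proof. by rewrite lt_def N_ge0 andbT N_eq0. Qed.

Lemma NM (x y : C) : N (x * y) = N x * N y.
Proof. exact: Normc.normcM. Qed.

Lemma NV (x : C) : N (x^-1) = (N x)^-1.
Proof. exact: Normc.normcV. Qed.

Lemma ND (x y : C) : N (x + y) <= N x + N y.
Proof. exact: le_normcD. Qed.

Lemma NN (x : C) : N (- x) = N x.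
Proof. exact: normcN. Qed.

Lemma NB (x y : C) : N (x - y) = N (y - x).
Proof. by rewrite -opprB NN. Qed.

Lemma NX (x : C) n : N (x ^+ n) = N x ^+ n.
Proof. by elim: n => [|n IH]; rewrite ?expr0 ?exprS ?NM ?IH //; exact: Normc.normc1. Qed.

Lemma N_real (a : R) : N (a%:C%C) = `|a|.
Proof. by rewrite /N /= expr0n /= addr0 sqrtr_sqr. Qed.

Lemma N_i : N 'i%C = 1.
Proof. by rewrite /N /= expr0n /= add0r expr1n sqrtr1. Qed.

Lemma N_nat n : N n%:R = n%:R.
Proof. by rewrite -[X in N X](@rmorph_nat R C (real_complex R)) N_real normr_nat. Qed.

Lemma ReB (x y : C) : complex.Re (x - y) = complex.Re x - complex.Re y.
Proof. by case: x; case: y. Qed.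

Lemma Re_le (x : C) : `|complex.Re x| <= N x.
Proof. by rewrite -(@lecR R) -normE; exact: normc_ge_Re. Qed.

Lemma N_le (a b : R) : N (a +i* b)%C <= `|a| + `|b|.
Proof.
have h : 0 <= `|a| + `|b| by rewrite addr_ge0.
rewrite -[leRHS](ger0_norm h) -sqrtr_sqr; apply: ler_wsqrtr.
rewrite sqrrD !real_normK ?num_real // mulr2n.
have : 0 <= `|a| * `|b| by rewrite mulr_ge0.
lra.
Qed.

Lemma near_C (z : C) (P : set C) :
  (\forall w \near z, P w) <-> exists2 d : R, 0 < d & forall w, N (w - z) < d -> P w.
Proof.
split=> [/nbhs_ballP [e /= e0 H]|[d d0 H]].
  (* A radius [e] in [R[i]] with [0 < e] has zero imaginary part, so its real part carries all the
     information. *)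
  exists (complex.Re e); first by move: e0; rewrite ltcE => /andP[].
  move=> w hw; apply: H; rewrite /ball /= -opprB normrN normE.
  move: e0; case: e hw => er ei /= hw; rewrite !ltcE /= => /andP[/eqP -> _].
  by rewrite eqxx /=.
apply/nbhs_ballP; exists (d%:C%C); first by rewrite /= ltcR.
by move=> w; rewrite /ball /= -opprB normrN normE ltcR => /H.
Qed.

Lemma near_R (t : R) (P : set R) :
  (\forall s \near t, P s) <-> exists2 d : R, 0 < d & forall s, `|s - t| < d -> P s.
Proof.
split=> [/nbhs_ballP [e /= e0 H]|[d d0 H]].
  by exists e => // s hs; apply: H; rewrite /ball /= -opprB normrN.
apply/nbhs_ballP; exists d => // w; rewrite /ball /= -opprB normrN => /H.
exact.
Qed.

Lemma cont_C (T : topologicalType) (F : T -> C) t :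
  {for t, continuous F} <-> forall e : R, 0 < e -> \forall s \near t, N (F s - F t) < e.
Proof.
split=> [/cvgrPdist_lt H e e0|H].
  have /H : 0 < e%:C%C :> C by rewrite ltcR.
  by apply: filterS => s; rewrite normE ltcR NB.
apply/cvgrPdist_lt => e e0.
have /H : 0 < complex.Re e by move: e0; rewrite ltcE => /andP[].
apply: filterS => s; rewrite normE NB.
move: e0; case: e => er ei /=; rewrite !ltcE /= => /andP[/eqP -> _].
by rewrite eqxx /=.
Qed.

Lemma cont_real (x : R) : {for x, continuous (fun t : R => t%:C%C : C)}.
Proof.
apply/cont_C => e e0; apply/near_R; exists e => // s hs.
have -> : s%:C%C - x%:C%C = (s - x)%:C%C :> C by rewrite rmorphB.
by rewrite N_real.
Qed.

Lemma cont_Re (x : C) : {for x, continuous (fun z : C => complex.Re z)}.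
Proof.
apply/(cvgrPdist_lt (FF := nbhs_filter x)) => e e0; apply/near_C; exists e => // w hw.
by rewrite -normrN opprB -raddfB; apply: le_lt_trans (Re_le _) hw.
Qed.

Lemma cont_N (x : C) : {for x, continuous N}.
Proof.
apply/(cvgrPdist_lt (FF := nbhs_filter x)) => e e0; apply/near_C; exists e => // w hw.
apply: le_lt_trans hw; rewrite ler_norml; apply/andP; split.
  have := ND x (w - x); rewrite addrC subrK; lra.
have := ND w (x - w); rewrite addrC subrK NB; lra.
Qed.

Lemma cont_id (z : C) : {for z, continuous (id : C -> C)}.
Proof. exact: cvg_id. Qed.

End basics.
Arguments cont_id {R} z.

Section continuity_rules.
Variable R : realType.
Local Notation C := (R[i]^o).
Variables (T : topologicalType) (t : T).
Implicit Types F G : T -> C.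
Lemma cont_cst (c : C) : {for t, continuous (fun _ : T => c)}.
Proof. exact: cvg_cst. Qed.

Lemma contD F G : {for t, continuous F} -> {for t, continuous G} ->
  {for t, continuous (fun s => F s + G s)}.
Proof. move=> cF cG. exact: (cvgD cF cG). Qed.

Lemma contN F : {for t, continuous F} -> {for t, continuous (fun s => - F s)}.
Proof. move=> cF. exact: (cvgN cF). Qed.

Lemma contB F G : {for t, continuous F} -> {for t, continuous G} ->
  {for t, continuous (fun s => F s - G s)}.
Proof. move=> cF cG. exact: (cvgB cF cG). Qed.

Lemma contM F G : {for t, continuous F} -> {for t, continuous G} ->
  {for t, continuous (fun s => F s * G s)}.
Proof. move=> cF cG; exact: (cvgM cF cG). Qed.

Lemma contV F : {for t, continuous F} -> F t != 0 ->
  {for t, continuous (fun s => (F s)^-1)}.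
Proof. move=> cF F0; exact: (cvgV F0 cF). Qed.
End continuity_rules.
Arguments cont_cst {R T t} c.

(** * Caratheodory derivatives *)

Section derivatives.
Variable R : realType.
Local Notation C := (R[i]^o).
Implicit Types (z l : C).

(* With [e := id] on [C] this is the complex derivative; with [e] the embedding of
   [R] into [C] it is the derivative of a path, for which the library has no
   notion since [R[i]^o] is not a normed module over [R]. *)
Definition deriv_along (T : topologicalType) (e F : T -> C) (t : T) (l : C) : Prop :=
  exists phi : T -> C, [/\ \forall s \near t, F s - F t = phi s * (e s - e t),
    {for t, continuous phi} & phi t = l].

Section rules.
Variables (T : topologicalType) (e : T -> C) (t : T).
Hypothesis ce : {for t, continuous e}.
Implicit Types F G : T -> C.

Lemma D_cont F l : deriv_along e F t l -> {for t, continuous F}.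
Proof.
case=> phi [H cphi _].
have H2 : {for t, continuous (fun s => phi s * (e s - e t) + F t)}.
  exact: contD (contM cphi (contB ce (cont_cst (e t)))) (cont_cst (F t)).
have E : {near t, (fun s => phi s * (e s - e t) + F t) =1 F}.
  by apply: filterS H => s <-; rewrite subrK.
have : (fun s => phi s * (e s - e t) + F t) @ t --> phi t * (e t - e t) + F t := H2.
rewrite (subrr (e t)) mulr0 add0r => H3.
exact: (cvg_trans (near_eq_cvg E) H3).
Qed.

Lemma D_cst c : deriv_along e (fun=> c) t 0.
Proof.
exists (fun=> 0); split; [|exact: cont_cst|by []].
by near=> s; rewrite subrr mul0r.
Unshelve. all: by end_near. Qed.

Lemma D_e : deriv_along e e t 1.
Proof.
exists (fun=> 1); split; [|exact: cont_cst|by []].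
by near=> s; rewrite mul1r.
Unshelve. all: by end_near. Qed.

Lemma D_add F G l m : deriv_along e F t l -> deriv_along e G t m ->
  deriv_along e (fun s => F s + G s) t (l + m).
Proof.
move=> [p [Hp cp <-]] [q [Hq cq <-]]; exists (fun s => p s + q s); split.
- by near=> s; rewrite mulrDl -(near Hp s)// -(near Hq s)// opprD addrACA.
- exact: contD.
- by [].
Unshelve. all: by end_near. Qed.

Lemma D_mul F G l m : deriv_along e F t l -> deriv_along e G t m ->
  deriv_along e (fun s => F s * G s) t (l * G t + F t * m).
Proof.
move=> HF HG; have cG := D_cont HG.
case: HF HG => [p [Hp cp <-]] [q [Hq cq <-]].
exists (fun s => p s * G s + F t * q s); split.
- near=> s; have h1 := near Hp s; have h2 := near Hq s.
  have -> : F s * G s - F t * G t = (F s - F t) * G s + F t * (G s - G t) by ring.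
  by rewrite h1 // h2 //; ring.
- exact: contD (contM cp cG) (contM (cont_cst (F t)) cq).
- by [].
Unshelve. all: by end_near. Qed.

Lemma D_eq F l m : deriv_along e F t l -> l = m -> deriv_along e F t m.
Proof. by move=> H <-. Qed.

Lemma D_scale c F l : deriv_along e F t l -> deriv_along e (fun s => c * F s) t (c * l).
Proof. by move=> H; apply: D_eq (D_mul (D_cst c) H) _; rewrite mul0r add0r. Qed.

Lemma cont_neq0 F : {for t, continuous F} -> F t != 0 -> \forall s \near t, F s != 0.
Proof.
move=> /cont_C cF F0; have : 0 < N (F t) by rewrite N_gt0.
move=> /cF; apply: filterS => s; apply: contraTN => /eqP ->.
by rewrite sub0r NN ltxx.
Qed.

Lemma D_inv F l : deriv_along e F t l -> F t != 0 ->
  deriv_along e (fun s => (F s)^-1) t (- l / F t ^+ 2).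
Proof.
move=> HF F0; have cF := D_cont HF; have nz := cont_neq0 cF F0.
case: HF => [p [Hp cp <-]].
exists (fun s => - p s * ((F s)^-1 * (F t)^-1)); split.
- near=> s; have h1 := near Hp s; have h2 : F s != 0 by near: s.
  transitivity (- (F s - F t) * ((F s)^-1 * (F t)^-1)); first by field; rewrite F0.
  by rewrite h1//; ring.
- exact: contM (contN cp) (contM (contV cF F0) (cont_cst (F t)^-1)).
- by field.
Unshelve. all: by end_near. Qed.

(** Divide [Q s - Q t = (F s - F t) * (F s + F t)] by the last factor, which stays away from 0
    because [F] is continuous and [F t != 0]. Continuity thus takes the place of a choice of
    branch. *)
Lemma D_sqrt F Q l : {for t, continuous F} -> F t != 0 ->
  (\forall s \near t, F s ^+ 2 = Q s) -> deriv_along e Q t l ->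
  deriv_along e F t (l / (2%:R * F t)).
Proof.
move=> cF F0 HQ [p [Hp cp <-]].
have cS : {for t, continuous (fun s => F s + F t)}.
  exact: contD cF (cont_cst (F t)).
have S0 : F t + F t != 0 by rewrite -mulr2n mulrn_eq0.
have nz := cont_neq0 cS S0.
have Q0 : F t ^+ 2 = Q t by exact: nbhs_singleton HQ.
exists (fun s => p s * (F s + F t)^-1); split.
- near=> s; have h1 := near Hp s; have h2 : F s + F t != 0 by near: s.
  have h3 := near HQ s.
  have: (F s - F t) * (F s + F t) = p s * (e s - e t).
    by rewrite -h1// -h3// -Q0; ring.
  move=> h; apply: (mulIf h2); rewrite h; field; exact: h2.
- exact: contM cp (contV cS S0).
- by congr (_ / _); rewrite mulr2n mulrDl mul1r.
Unshelve. all: by end_near. Qed.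

Lemma D_comp (f : C -> C) F l m : deriv_along id f (F t) l -> deriv_along e F t m ->
  deriv_along e (fun s => f (F s)) t (l * m).
Proof.
move=> [p [Hp cp <-]] HF; have cF := D_cont HF.
case: HF => [q [Hq cq <-]].
exists (fun s => p (F s) * q s); split.
- have := cF _ Hp; rewrite nbhs_simpl /= => Hp'.
  near=> s; have h1 : f (F s) - f (F t) = p (F s) * (F s - F t) by near: s.
  by rewrite h1 (near Hq s)// mulrA.
- exact: contM (continuous_comp cF cp) cq.
- by [].
Unshelve. all: by end_near. Qed.

End rules.

Arguments D_cst {T e t} c.
Arguments D_e {T e t}.

Lemma D_derivable (f : C -> C) z : derivable f z 1 -> deriv_along id f z ('D_1 f z).
Proof.
move=> df; set l := 'D_1 f z.
exists (fun w => if w == z then l else (f w - f z) / (w - z)); split.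
- near=> w; case: eqP => [->|/eqP]; first by rewrite !subrr mulr0.
  by rewrite -subr_eq0 => h; rewrite divfK.
- apply/cont_C => e e0.
  have /cvgrPdist_lt/(_ e%:C%C) :=
    (df : (fun h : C => h^-1 *: ((f \o shift z) (h *: (1 : C)) - f z))
      @ (0 : C)^' --> l).
  rewrite ltcR => /(_ e0) /(@near_C R 0) [d d0 H].
  apply/near_C; exists d => // w hw; rewrite eqxx.
  case: eqP => [_|/eqP wz]; first by rewrite subrr N0.
  have wz' : w - z != 0 by rewrite subr_eq0.
  have := H (w - z); rewrite subr0 => /(_ hw wz') /=.
  rewrite normE ltcR NB /= [(w - z) *: _]mulr1 subrK.
  by rewrite /GRing.scale /= mulrC.
- by rewrite eqxx.
Unshelve. all: by end_near. Qed.

Lemma D_real (F : R -> C) t l : deriv_along (fun s : R => s%:C%C : C) F t l ->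
  is_derive t 1 (fun s => complex.Re (F s)) (complex.Re l).
Proof.
move=> [p [Hp cp <-]]; apply/is_derive1_caratheodory.
pose g s := complex.Re (F s).
(* The slope in [is_derive1_caratheodory] must satisfy its identity at every point, whereas that of
   [p] holds only near [t]; hence the difference quotient itself. *)
pose G s := if s == t then complex.Re (p t) else (g s - g t) / (s - t).
have Gt : G t = complex.Re (p t) by rewrite /G eqxx.
exists G; rewrite /G; split.
- move=> s; case: eqP => [->|/eqP]; first by rewrite !subrr mulr0.
  by rewrite -subr_eq0 => h; rewrite divfK.
- have c2 : {for t, continuous (fun s => complex.Re (p s))}.
    exact: (continuous_comp cp (@cont_Re R _)).
  change (G @ t --> G t); rewrite Gt.
  apply: cvg_trans c2; apply: near_eq_cvg; rewrite /G.
  near=> s; case: eqP => [->//|/eqP st].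
  have st' : s - t != 0 by rewrite subr_eq0.
  have h : F s - F t = p s * (s%:C%C - t%:C%C) by near: s.
  apply: (mulIf st'); rewrite divfK // /g -raddfB h.
  by rewrite -(rmorphB (real_complex R)); case: (p s) => a b /=; ring.
- by rewrite eqxx.
Unshelve. all: by end_near. Qed.

Lemma D_of_real (f g : R -> R) (t a b : R) : is_derive t 1 f a -> is_derive t 1 g b ->
  deriv_along (fun s : R => s%:C%C : C) (fun s => (f s +i* g s)%C) t (a +i* b)%C.
Proof.
move=> /is_derive1_caratheodory [p [Hp cp <-]] /is_derive1_caratheodory [q [Hq cq <-]].
exists (fun s => (p s +i* q s)%C); split.
- near=> s; rewrite -(rmorphB (real_complex R)) /=.
  apply/eqP; rewrite eq_complex /=; apply/andP.
  by rewrite Hp Hq; split; apply/eqP; ring.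
- have -> : (fun s => (p s +i* q s)%C) = (fun s => (p s)%:C%C + 'i%C * (q s)%:C%C) :> (R -> C).
    by apply/funext => s; apply/eqP; rewrite eq_complex /=; apply/andP; split; apply/eqP; ring.
  exact: contD (continuous_comp cp (@cont_real R _))
    (contM (cont_cst ('i%C : C)) (continuous_comp cq (@cont_real R _))).
- by [].
Unshelve. all: by end_near. Qed.

End derivatives.
Arguments D_cst {R T e t} c.
Arguments D_e {R T e t}.

(** * Darboux property and continuity of algebraic derivatives *)

(** The function [f t - y * t] has negative derivative at 0 and positive derivative at 1, so its
    minimum on the segment is interior and its derivative vanishes there. *)
Lemma darboux (R : realType) (f df : R -> R) (y : R) :
  (forall t : R, 0 <= t <= 1 -> is_derive t 1 f (df t)) -> df 0 < y -> y < df 1 ->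
  exists2 t : R, 0 <= t <= 1 & df t = y.
Proof.
move=> Df d0 d1.
pose h t := f t - y * t.
have Dh (t : R) : 0 <= t <= 1 -> is_derive t 1 h (df t - y).
  move=> /Df ft; have : is_derive t 1 (fun s : R => f s - y *: s) (df t - y *: 1).
    exact: is_deriveB.
  by rewrite /GRing.scale /= mulr1.
have ch (t : R) : 0 <= t <= 1 -> {for t, continuous h}.
  by move=> /Dh ht; apply/differentiable_continuous/derivable1_diffP; exact: ex_derive.
have [c c01 cmin] : exists2 c : R, c \in `[0, 1] & forall t : R, t \in `[0, 1] -> h c <= h t.
  apply: EVT_min => //; apply: continuous_in_subspaceT => t.
  by rewrite inE /= in_itv /= => /ch.
have cmin' (t : R) : 0 <= t <= 1 -> h c <= h t.
  by move=> ht; apply: cmin; rewrite in_itv.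
move: c01; rewrite in_itv /= => /andP[c0 c1].
have slope (s : R) : 0 <= s <= 1 -> exists g : R -> R,
    [/\ forall z, h z - h s = g z * (z - s), {for s, continuous g} & g s = df s - y].
  by move=> /Dh /is_derive1_caratheodory.
(* If the minimum were at an endpoint, the slope of [h] near it would keep the sign of the
   derivative there, and a point [s] further inside would give a smaller value. *)
have c_gt0 : 0 < c.
  rewrite lt_neqAle c0 andbT; apply/eqP => ec.
  have [g [hg cg g0]] := slope 0 (introT andP (conj (lexx 0) ler01)).
  have : 0 < y - df 0 by lra.
  move/cvgrPdist_lt : cg => /[apply] /near_R [d d0' H].
  pose s := Num.min (d / 2) 1.
  have s0 : 0 < s by rewrite lt_min; apply/andP; split; lra.
  have sd : s <= d / 2 by rewrite ge_min lexx.
  have s1 : s <= 1 by rewrite ge_min lexx orbT.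
  have := H s; rewrite subr0 gtr0_norm // g0 => /(_ ltac:(lra)).
  move/ltr_normlP => [h1 h2].
  have := cmin' s ltac:(lra); have := hg s; rewrite -ec subr0 => e1 e2.
  have : g s * s < 0 by rewrite pmulr_llt0 //; lra.
  by lra.
have c_lt1 : c < 1.
  rewrite lt_neqAle c1 andbT; apply/eqP => ec.
  have [g [hg cg g0]] := slope 1 (introT andP (conj ler01 (lexx 1))).
  have : 0 < df 1 - y by lra.
  move/cvgrPdist_lt : cg => /[apply] /near_R [d d0' H].
  pose s := Num.min (d / 2) 1.
  have s0 : 0 < s by rewrite lt_min; apply/andP; split; lra.
  have sd : s <= d / 2 by rewrite ge_min lexx.
  have s1 : s <= 1 by rewrite ge_min lexx orbT.
  have := H (1 - s); rewrite addrAC subrr add0r normrN gtr0_norm // g0 => /(_ ltac:(lra)).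
  move/ltr_normlP => [h1 h2].
  have := cmin' (1 - s) ltac:(lra); have := hg (1 - s); rewrite ec => e1 e2.
  have : 0 < g (1 - s) * s by rewrite pmulr_lgt0 //; lra.
  by lra.
exists c; first by rewrite c0 c1.
have Dc : is_derive c 1 h 0.
  apply: (@derive1_at_min _ h 0 1) => //.
  - move=> t; rewrite in_itv /= => /andP[t0 t1].
    by have /Dh ht : 0 <= t <= 1 by lra; exact: ex_derive.
  - by rewrite in_itv /= c_gt0 c_lt1.
  - by move=> t; rewrite in_itv /= => /andP[t0 t1]; apply: cmin'; lra.
have /Dh Dc' : 0 <= c <= 1 by lra.
have := @derive_val _ _ _ _ _ _ _ Dc; rewrite (@derive_val _ _ _ _ _ _ _ Dc').
lra.
Qed.

(** By induction on [S]: pass to the half of the interval whose interior misses [s]. The margin [d]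
    kept from the ends of that half is then also a distance from [s]. *)
Lemma avoid_finite (R : realFieldType) (S : seq R) (x y : R) : x < y ->
  exists m d, [/\ 0 < d, x + d <= m, m + d <= y & forall s, s \in S -> d <= `|m - s|].
Proof.
elim: S x y => [|s S IH] x y xy.
  by exists ((x + y) / 2), ((y - x) / 2); split => //; lra.
have [le_s|lt_s] := lerP ((x + y) / 2) s.
  have [|m [d [d0 h1 h2 h3]]] := IH x ((x + y) / 2); first lra.
  exists m, d; split => //; first lra.
  move=> t; rewrite inE => /orP[/eqP ->|/h3//].
  by rewrite ler_normr; apply/orP; right; lra.
have [|m [d [d0 h1 h2 h3]]] := IH ((x + y) / 2) y; first lra.
exists m, d; split => //; first lra.
move=> t; rewrite inE => /orP[/eqP ->|/h3//].
by rewrite ler_normr; apply/orP; left; lra.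
Qed.

Section complex_derivative.
Variable R : realType.
Local Notation C := (R[i]^o).
Local Notation Dc := (deriv_along (id : C -> C)).
Local Notation Dr := (deriv_along (fun s : R => s%:C%C : C)).

Lemma N_sq (x : C) : complex.Re ((x^*)%C * x) = N x ^+ 2.
Proof.
case: x => a b; rewrite /N /= sqr_sqrtr; first ring.
by rewrite addr_ge0 // sqr_ge0.
Qed.

Lemma N_conj (x : C) : N ((x^*)%C) = N x.
Proof. by case: x => a b; rewrite /N /= sqrrN. Qed.

(** With [v = F T - F 0], the real mean value theorem applies to the real part of [v^* * F t], whose
    increment over the interval is [N v ^+ 2]. *)
Lemma N_mvt (F l : R -> C) (T M : R) : 0 <= T ->
  (forall t : R, 0 <= t <= T -> Dr F t (l t)) ->
  (forall t : R, 0 <= t <= T -> N (l t) <= M) -> N (F T - F 0) <= M * T.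
Proof.
move=> T0 DF hM.
have M0 : 0 <= M by apply: le_trans (hM 0 _); rewrite ?N_ge0 // lexx T0.
move: T0; rewrite le_eqVlt => /orP[/eqP <-|T0]; first by rewrite subrr N0 mulr0.
set v := F T - F 0.
have [v0|v0] := eqVneq v 0; first by rewrite v0 N0 mulr_ge0 // ltW.
pose g t := complex.Re ((v^*)%C * F t).
pose dg t := complex.Re ((v^*)%C * l t).
have Dg (t : R) : 0 <= t <= T -> is_derive t 1 g (dg t).
  by move=> /DF H; apply: D_real; apply: D_scale => //; exact: cont_real.
have [||c] := @MVT R g dg 0 T T0.
- by move=> t; rewrite in_itv /= => /andP[t0 t1]; apply: Dg; rewrite !ltW.
- apply: continuous_in_subspaceT => t; rewrite inE /= in_itv /= => /Dg ht.
  by apply/differentiable_continuous/derivable1_diffP; exact: ex_derive.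
rewrite in_itv /= => /andP[c0 c1]; rewrite subr0 => gT.
have e : N v ^+ 2 = dg c * T by rewrite -gT -N_sq {2}/v mulrBr ReB.
have h : dg c <= N v * M.
  apply: le_trans (ler_norm _) _; apply: le_trans (Re_le _) _.
  by rewrite NM N_conj ler_wpM2l ?N_ge0 // hM // !ltW.
have Nv : 0 < N v by rewrite N_gt0.
rewrite -(ler_pM2l Nv) -expr2 e mulrA ler_wpM2r //; exact: ltW.
Qed.

Lemma N_prod_ge (S : seq C) (x : C) (d : R) : 0 <= d ->
  (forall a, a \in S -> d <= N (x - a)) -> d ^+ size S <= N (\prod_(a <- S) (x - a)).
Proof.
move=> d0; elim: S => [|a S IH] H.
  by rewrite big_nil expr0 N1.
rewrite big_cons NM /= exprS ler_pM ?exprn_ge0 //; first by apply: H; rewrite mem_head.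
by apply: IH => b bS; apply: H; rewrite inE bS orbT.
Qed.

(* If [Re p] exceeded [Re (p z)] by [e] at [w], then by the Darboux property it
   would take on the segment from [z] to [w] an intermediate value [m] chosen away
   from the real parts of the points of [S]. *)
Lemma derivative_Re_le (f p : C -> C) (z : C) (r : R) (S : seq C) : 0 < r ->
  (forall w, N (w - z) < r -> Dc f w (p w)) ->
  (forall e : R, 0 < e -> \forall w \near z, N (\prod_(a <- S) (p w - a)) < e) ->
  forall e : R, 0 < e -> \forall w \near z, complex.Re (p w) <= complex.Re (p z) + e.
Proof.
move=> r0 Df HS e e0.
have [|m [d [d0 m1 m2 hm]]] := @avoid_finite R [seq complex.Re a | a <- S]
  (complex.Re (p z)) (complex.Re (p z) + e); first lra.
have /near_C [d1 d1_gt0 H1] := HS _ (exprn_gt0 (size S) d0).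
apply/near_C; exists (Num.min d1 r); first by rewrite lt_min d1_gt0.
move=> w; rewrite lt_min => /andP[w1 w2]; rewrite leNgt; apply/negP => hw.
have wz : w - z != 0.
  by rewrite subr_eq0; apply/eqP => wz; move: hw; rewrite wz; lra.
pose q (t : R) : C := z + t%:C%C * (w - z).
have Nq (t : R) : 0 <= t <= 1 -> N (q t - z) <= N (w - z).
  move=> /andP[t0 t1]; rewrite /q addrAC subrr add0r NM N_real ger0_norm //.
  by rewrite -[leRHS]mul1r ler_wpM2r ?N_ge0.
have Dq (t : R) : Dr q t (w - z).
  have ce := @cont_real R t.
  apply: D_eq (D_add (D_cst z) (D_mul ce D_e (D_cst (w - z)))) _.
  by rewrite mulr0 addr0 add0r mul1r.
have Dg (t : R) : 0 <= t <= 1 -> is_derive t 1 (fun s => complex.Re ((w - z)^-1 * f (q s)))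
    (complex.Re (p (q t))).
  move=> ht; apply: D_real; have ce := @cont_real R t.
  apply: D_eq (D_scale ce (w - z)^-1 (D_comp ce (Df _ _) (Dq t))) _.
    exact: le_lt_trans (Nq _ ht) w2.
  by rewrite mulrC mulfK.
have q0 : q 0 = z by rewrite /q mul0r addr0.
have q1 : q 1 = w by rewrite /q mul1r addrC subrK.
have [||t t01 ht] := @darboux R _ (fun t => complex.Re (p (q t))) m Dg.
- by rewrite q0; lra.
- by rewrite q1; lra.
have := H1 (q t) (le_lt_trans (Nq _ t01) w1); apply/negP; rewrite -leNgt.
apply: N_prod_ge; first exact: ltW.
move=> a aS; apply: le_trans (Re_le _); rewrite ReB ht; apply: hm.
exact: map_f.
Qed.

(** The product hypothesis says that [p w] approaches the finite set [S] as [w] tends to [z], and a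
    derivative cannot jump between points of [S]. The one-sided bound on real parts, applied to
    [c * f] for [c] equal to 1, -1, i and -i, controls both coordinates of [p w - p z]. *)
Lemma derivative_continuous (f p : C -> C) (z : C) (r : R) (S : seq C) : 0 < r ->
  (forall w, N (w - z) < r -> Dc f w (p w)) ->
  (forall e : R, 0 < e -> \forall w \near z, N (\prod_(a <- S) (p w - a)) < e) ->
  {for z, continuous p}.
Proof.
move=> r0 Df HS.
have side (c : C) (e : R) : N c = 1 -> 0 < e ->
    \forall w \near z, complex.Re (c * (p w - p z)) <= e.
  move=> c1 e0.
  have Dcf w : N (w - z) < r -> Dc (fun w => c * f w) w (c * p w).
    by move=> /Df; apply: D_scale; exact: cvg_id.
  have HcS e' : 0 < e' ->
     \forall w \near z, N (\prod_(a <- [seq c * a | a <- S]) (c * p w - a)) < e'.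
    move=> /HS; apply: filterS => w; congr (_ < _); rewrite big_map.
    elim: S {HS} => [|a S IH]; rewrite ?big_nil // !big_cons NM IH -mulrBr.
    by rewrite !NM c1 mul1r.
  have := derivative_Re_le r0 Dcf HcS e0; apply: filterS => w.
  by rewrite mulrBr ReB; lra.
apply/cont_C => e e0.
have e4 : 0 < e / 4 by lra.
have N1 := N1 R.
near=> w.
have h1 : complex.Re (1 * (p w - p z)) <= e / 4 by near: w; apply: side.
have h2 : complex.Re (- 1 * (p w - p z)) <= e / 4 by near: w; apply: side; rewrite ?NN.
have h3 : complex.Re ('i%C * (p w - p z)) <= e / 4.
  by near: w; apply: side; rewrite ?N_i.
have h4 : complex.Re (- 'i%C * (p w - p z)) <= e / 4.
  by near: w; apply: side; rewrite ?NN ?N_i.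
move: h1 h2 h3 h4; case: (p w - p z) => a b /= h1 h2 h3 h4.
apply: le_lt_trans (N_le _ _) _.
have ha : `|a| <= e / 4 by rewrite ler_norml; lra.
have hb : `|b| <= e / 4 by rewrite ler_norml; lra.
lra.
Unshelve. all: by end_near. Qed.

End complex_derivative.

(** * Logarithmic derivatives along circles *)

Section winding.
Variable R : realType.
Local Notation C := (R[i]^o).
Local Notation Dc := (deriv_along (id : C -> C)).
Local Notation Dr := (deriv_along (fun s : R => s%:C%C : C)).

Definition expi (a t : R) : C := (cos (a * t) +i* sin (a * t))%C.

Lemma N_expi (a t : R) : N (expi a t) = 1.
Proof. by rewrite /N /expi /= cos2Dsin2 sqrtr1. Qed.

Lemma expi0 (a : R) : expi a 0 = 1.
Proof. by rewrite /expi mulr0 cos0 sin0. Qed.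

Lemma expi1_2pi : expi 1 (2 * pi) = 1.
Proof. by rewrite /expi mul1r mulr_natl cos2pi sin2pi. Qed.

Lemma D_expi (a t : R) : Dr (expi a) t ('i%C * a%:C%C * expi a t).
Proof.
have Da : is_derive t 1 (fun s : R => a * s) a.
  have : is_derive t 1 (fun s : R => a *: s) (a *: 1) by exact: is_deriveZ.
  by rewrite /GRing.scale /= mulr1.
have Dcos : is_derive t 1 (fun s : R => cos (a * s)) (- sin (a * t) * a).
  exact: (@is_derive1_comp R cos _ t _ _ (is_derive_cos _) Da).
have Dsin : is_derive t 1 (fun s : R => sin (a * s)) (cos (a * t) * a).
  exact: (@is_derive1_comp R sin _ t _ _ (is_derive_sin _) Da).
apply: D_eq (D_of_real Dcos Dsin) _.
by apply/eqP; rewrite eq_complex /=; apply/andP; split; apply/eqP; ring.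
Qed.

Lemma pi_le4 : pi <= 4 :> R.
Proof. have [] := @pihalf_02_cos_pihalf R; lra. Qed.

Lemma cos_le_N_expi (a t : R) : 1 - cos (a * t) <= N (expi a t - 1).
Proof.
apply: le_trans (Re_le _); rewrite /= -normrN opprB; exact: ler_norm.
Qed.

(* The hypotheses say that [F] almost satisfies [F' = i a F], while
   [exp (- 2 i pi a)] is far from 1; the mean value inequality is applied to
   [F t * exp (- i a t)]. *)
Lemma winding (a : R) (F l : R -> C) :
  (forall t : R, 0 <= t <= 2 * pi -> Dr F t (l t)) ->
  (forall t : R, 0 <= t <= 2 * pi ->
    N (l t - 'i%C * a%:C%C * F t) <= 20^-1 * N (F t)) ->
  F (2 * pi) = F 0 -> cos (- a * (2 * pi)) <= 0 -> F 0 = 0.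
Proof.
move=> DF hl per ha.
have pi2 := @pi_ge2 R; have pi4 := pi_le4.
have T0 : 0 <= 2 * pi :> R by lra.
have [c] : exists2 c : R, c \in `[0, 2 * pi] &
    forall t : R, t \in `[0, 2 * pi] -> N (F t) <= N (F c).
  apply: EVT_max => //; apply: continuous_in_subspaceT => t.
  rewrite inE /= in_itv /= => /DF ht.
  exact: continuous_comp (D_cont (@cont_real R t) ht) (@cont_N R _).
rewrite in_itv /= => /andP[c0 cT] cmax.
set M := N (F c) in cmax.
have hM (t : R) : 0 <= t <= 2 * pi -> N (F t) <= M.
  by move=> ht; apply: cmax; rewrite in_itv.
pose G t := F t * expi (- a) t.
pose dG t := (l t - 'i%C * a%:C%C * F t) * expi (- a) t.
have DG (t : R) : 0 <= t <= 2 * pi -> Dr G t (dG t).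
  move=> /DF ht; apply: D_eq (D_mul (@cont_real R t) ht (D_expi (- a) t)) _.
  by rewrite /dG rmorphN /=; ring.
have hG (t : R) : 0 <= t <= 2 * pi -> N (dG t) <= 20^-1 * M.
  move=> ht; rewrite NM N_expi mulr1; apply: le_trans (hl _ ht) _.
  by rewrite ler_wpM2l // hM.
have M0 : 0 <= M by exact: N_ge0.
(* The constant is [8 / 20], since [2 * pi <= 8]. *)
have bound (s : R) : 0 <= s <= 2 * pi -> N (G s - F 0) <= 2 / 5 * M.
  move=> /andP[s0 sT].
  have -> : F 0 = G 0 by rewrite /G expi0 mulr1.
  have le t : 0 <= t <= s -> 0 <= t <= 2 * pi by move=> /andP[? ?]; lra.
  have H1 : N (G s - G 0) <= 20^-1 * M * s.
    by apply: (N_mvt s0) => t /le; [exact: DG | exact: hG].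
  have : 20^-1 * M * s <= 20^-1 * M * 8 by rewrite ler_wpM2l //; lra.
  lra.
have b1 := bound c ltac:(lra); have b2 := bound (2 * pi) ltac:(lra).
have NGc : N (G c) = M by rewrite NM N_expi mulr1.
have t1 : M <= N (G c - F 0) + N (F 0) by rewrite -NGc -{1}(subrK (F 0) (G c)) ND.
have e2 : G (2 * pi) - F 0 = F 0 * (expi (- a) (2 * pi) - 1) by rewrite /G per; ring.
have t2 : N (F 0) <= N (G (2 * pi) - F 0).
  rewrite e2 NM -[leLHS]mulr1 ler_wpM2l ?N_ge0 //.
  by apply: le_trans (cos_le_N_expi _ _); lra.
(* Here [M <= 2/5 M + N (F 0)] and [N (F 0) <= 2/5 M], whence [M <= 4/5 M], so [M] and then [F 0]
   vanish. *)
apply/eqP; rewrite -N_eq0 eq_le N_ge0 andbT; lra.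
Qed.

Lemma cos_half_turn : cos (- (1 / 2) * (2 * pi)) <= 0 :> R.
Proof.
have -> : - (1 / 2) * (2 * pi) = - pi :> R by lra.
by rewrite cosN cospi; lra.
Qed.

Lemma cos_four_thirds_turn : cos (- (4 / 3) * (2 * pi)) <= 0 :> R.
Proof.
(* Modulo a full turn the angle is [2 pi / 3] up to sign, so the cosine is [- sin (pi / 6)]. *)
have -> : - (4 / 3) * (2 * pi) = - (pi / 6 + pi / 2 + pi *+ 2) :> R by lra.
rewrite cosN cosD cos2pi sin2pi mulr1 mulr0 subr0 cosDpihalf oppr_le0.
have := @pi_ge2 R => h; apply: sin_ge0_pi; lra.
Qed.

Definition circle (c w : C) (t : R) : C := c + w * expi 1 t.

Lemma D_circle (c w : C) (t : R) : Dr (circle c w) t ('i%C * (circle c w t - c)).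
Proof.
apply: D_eq (D_add (D_cst c) (D_scale (@cont_real R t) w (D_expi 1 t))) _.
by rewrite /circle; ring.
Qed.

Lemma N_circle (c w : C) (t : R) : N (circle c w t - c) = N w.
Proof. by rewrite /circle addrAC subrr add0r NM N_expi mulr1. Qed.

Lemma circle0 (c w : C) : circle c w 0 = c + w.
Proof. by rewrite /circle expi0 mulr1. Qed.

Lemma circle_2pi (c w : C) : circle c w (2 * pi) = c + w.
Proof. by rewrite /circle expi1_2pi mulr1. Qed.

(** The zeros of [F] in [[0, T]] form a closed set by continuity, so their infimum is itself a
    zero. *)
Lemma first_zero (F : R -> C) (T : R) :
  (forall t : R, 0 <= t <= T -> {for t, continuous F}) ->
  (exists2 t : R, 0 <= t <= T & F t = 0) ->
  exists t : R, [/\ 0 <= t <= T, F t = 0 & forall s, 0 <= s < t -> F s != 0].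
Proof.
move=> cF [t1 t1T F1].
pose A := [set t : R | 0 <= t <= T /\ F t = 0].
have A1 : A t1 by [].
have lbA : lbound A 0 by move=> t [/andP[]].
have infA : has_inf A by split; [exists t1 | exists 0].
have inf_le t : A t -> inf A <= t by move=> At; apply: ge_inf => //; exists 0.
have inf_ge0 : 0 <= inf A by apply: lb_le_inf => //; exists t1.
have infT : 0 <= inf A <= T.
  by rewrite inf_ge0 /=; apply: le_trans (inf_le _ A1) _; case/andP: t1T.
exists (inf A); split => //.
- apply/eqP; rewrite -[_ == _]negbK; apply/negP => h.
  have /near_R [d d0 hd] := cont_neq0 (cF _ infT) h.
  have [s As sd] := inf_adherent d0 infA.
  have := hd s; rewrite ger0_norm ?subr_ge0 ?inf_le //.
  by have [_ ->] := As; rewrite eqxx => /(_ ltac:(lra)).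
- move=> s /andP[s0 st]; apply/eqP => Fs.
  have sT : 0 <= s <= T by rewrite s0; case/andP: infT => _; lra.
  by have := inf_le s (conj sT Fs); rewrite leNgt st.
Qed.

End winding.

(* Prevents conversion from unfolding moduli when [lra] compares atoms. *)
Local Opaque N.

(** * The equation near a zero *)

Section local_analysis.
Variable R : realType.
Local Notation C := (R[i]^o).
Local Notation Dc := (deriv_along (id : C -> C)).
Local Notation Dr := (deriv_along (fun s : R => s%:C%C : C)).

(** The right-hand side of the equation, called k in the opening comment. *)
Definition quintic (y : C) : C := y * (y - 1) ^+ 2 * (4%:R * y - 3%:R) ^+ 2.
Definition dquintic (y : C) : C := (y - 1) ^+ 2 * (4%:R * y - 3%:R) ^+ 2
  + y * (2%:R * (y - 1)) * (4%:R * y - 3%:R) ^+ 2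
  + y * (y - 1) ^+ 2 * (8%:R * (4%:R * y - 3%:R)).

Lemma D_quintic (y : C) : Dc quintic y (dquintic y).
Proof.
have ce := cont_id y.
have D1 : Dc (fun s => s - 1) y 1.
  by apply: D_eq (D_add D_e (D_cst (- 1))) _; rewrite addr0.
have D2 : Dc (fun s => 4%:R * s - 3%:R) y 4%:R.
  by apply: D_eq (D_add (D_scale ce 4%:R D_e) (D_cst (- 3%:R))) _; rewrite addr0 mulr1.
apply: D_eq (D_mul ce (D_mul ce D_e (D_mul ce D1 D1)) (D_mul ce D2 D2)) _.
by rewrite /dquintic; ring.
Qed.

Lemma cont_quintic (y : C) : {for y, continuous quintic}.
Proof. exact: (D_cont (cont_id y) (D_quintic y)). Qed.

Lemma N_sub_ge (x y : C) : N y - N x <= N (x - y).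
Proof. by have := ND (y - x) x; rewrite subrK NB; lra. Qed.

Lemma factors_ge (y : C) : N y <= 1000^-1 ->
  999 / 1000 <= N (y - 1) /\ 2996 / 1000 <= N (4%:R * y - 3%:R).
Proof.
move=> hy; split.
  by have := N_sub_ge y 1; rewrite N1; lra.
have := N_sub_ge (4%:R * y) 3%:R; rewrite NM !N_nat; lra.
Qed.

Lemma quintic_neq0 (y : C) : y != 0 -> N y <= 1000^-1 -> quintic y != 0.
Proof.
rewrite -!N_gt0 => y0 /factors_ge [h1 h2].
by rewrite /quintic !NM !mulr_gt0 //; lra.
Qed.

(** Since k(y) = y v^2 with v = (y - 1)(4 y - 3), one has y k' - k = 2 y^2 v v', and 2 v' = 16 y -
    14. Relative to k this is 2 y v' / v, at most about 0.015 / 2.99. Hence y k' / k is close to 1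
    near the simple zero 0 of k. *)
Lemma quintic_log_derivative (y : C) : N y <= 1000^-1 ->
  N (y * dquintic y - quintic y) <= 100^-1 * N (quintic y).
Proof.
move=> hy; have [h1 h2] := factors_ge hy.
pose v := (y - 1) * (4%:R * y - 3%:R).
have -> : y * dquintic y - quintic y = (y * v) * (y * (16%:R * y - 14%:R)).
  by rewrite /v /dquintic /quintic; ring.
have -> : quintic y = (y * v) * v by rewrite /v /quintic; ring.
rewrite (NM (y * v)) (NM (y * v) v) [leRHS]mulrCA ler_wpM2l ?N_ge0 //.
have h3 : N (16%:R * y - 14%:R) <= 15.
  have := ND (16%:R * y) (- 14%:R); rewrite NN NM !N_nat; lra.
have h4 : N (y * (16%:R * y - 14%:R)) <= 1000^-1 * 15.
  by rewrite NM ler_pM ?N_ge0.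
have h5 : 999 / 1000 * (2996 / 1000) <= N v.
  by rewrite [N v]NM; apply: ler_pM h1 h2; lra.
apply: le_trans h4 _; move: (N v) h5 => nv h5; clear -h5; lra.
Qed.

Section ode.
Variables (f p : C -> C) (z0 : C) (r : R) (L : C).
Hypothesis r0 : 0 < r.
Hypothesis Df : forall w, N (w - z0) < r -> Dc f w (p w).
Let g w := 9%:R / 8%:R * p w ^+ 2 + L * (f w - 1).
Hypothesis ode : forall w, N (w - z0) < r -> g w ^+ 2 = quintic (f w).

Lemma near_ball w : N (w - z0) < r -> \forall s \near w, N (s - z0) < r.
Proof.
move=> hw; apply/near_C; exists (r - N (w - z0)); first by rewrite subr_gt0.
move=> s hs; have := ND (s - w) (w - z0); rewrite addrA subrK; lra.
Qed.

Lemma f_cont w : N (w - z0) < r -> {for w, continuous f}.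
Proof. by move=> /Df h; exact: (D_cont (cont_id w) h). Qed.

Lemma p_cont w : N (w - z0) < r -> {for w, continuous p}.
Proof.
move=> hw; have cf := f_cont hw.
have [d d0 hd] := (near_C _ _).1 (near_ball hw).
pose A := L * (f w - 1); pose B := sqrtc (quintic (f w)).
(* The four values of [p w] allowed by the equation are [r1], [- r1], [r2], [- r2]. *)
pose r1 := sqrtc (8%:R / 9%:R * (B - A)); pose r2 := sqrtc (8%:R / 9%:R * (- B - A)).
apply: (derivative_continuous (S := [:: r1; - r1; r2; - r2]) d0).
  by move=> s /hd; exact: Df.
move=> e e0.
pose eta s := L * (f w - f s).
have ce : {for w, continuous eta}.
  exact: contM (cont_cst L) (contB (cont_cst (f w)) cf).
have ckf : {for w, continuous (fun s => quintic (f s))}.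
  exact: continuous_comp cf (@cont_quintic (f w)).
have ca : {for w, continuous (fun s => quintic (f s) + eta s * eta s)}.
  exact: contD ckf (contM ce ce).
have cb : {for w, continuous (fun s => quintic (f s) * (eta s * eta s))}.
  exact: contM ckf (contM ce ce).
have eta0 : eta w = 0 by rewrite /eta subrr mulr0.
have e4 : 0 < e / 4 by lra.
have h1 := (cont_C _ _).1 ca _ e4; have h2 := (cont_C _ _).1 cb _ (exprn_gt0 2 e4).
rewrite eta0 !mulr0 addr0 in h1; rewrite eta0 !mulr0 in h2.
have h3 := near_ball hw.
near=> s.
have hs : N (s - z0) < r by near: s.
have i1 : N (quintic (f s) + eta s * eta s - quintic (f w)) < e / 4 by near: s.
have i2 : N (quintic (f s) * (eta s * eta s) - 0) < (e / 4) ^+ 2 by near: s.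
(* Continuity of [g] is not yet available, but the square of [g * eta] is
   [quintic (f s) * eta s ^+ 2], which is continuous and vanishes at [w]. *)
have h4 : N (g s * eta s) < e / 4.
  rewrite -(@ltr_pXn2r _ 2) ?nnegrE ?N_ge0 //; last exact: ltW.
  rewrite -NX (_ : (g s * eta s) ^+ 2 = quintic (f s) * (eta s * eta s) - 0) //.
  by rewrite subr0 -ode // exprMn expr2 [eta s ^+ 2]expr2.
have E : \prod_(a <- [:: r1; - r1; r2; - r2]) (p s - a) =
    64%:R / 81%:R * ((quintic (f s) + eta s * eta s - quintic (f w)) + 2%:R * (g s * eta s)).
  have e1 : r1 ^+ 2 = 8%:R / 9%:R * (B - A) by exact: sqr_sqrtc.
  have e2 : r2 ^+ 2 = 8%:R / 9%:R * (- B - A) by exact: sqr_sqrtc.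
  have e3 : B ^+ 2 = quintic (f w) by exact: sqr_sqrtc.
  rewrite !big_cons big_nil.
  transitivity ((p s ^+ 2 - r1 ^+ 2) * (p s ^+ 2 - r2 ^+ 2)); first by ring.
  rewrite e1 e2 -e3 -ode // /g /eta /A.
  by field.
rewrite E NM.
have : N (quintic (f s) + eta s * eta s - quintic (f w) + 2%:R * (g s * eta s)) < e.
  by apply: le_lt_trans (ND _ _) _; rewrite [X in _ + X]NM N_nat; lra.
have -> : N (64%:R / 81%:R : C) = 64 / 81 by rewrite NM NV !N_nat.
have := N_ge0 (quintic (f s) + eta s * eta s - quintic (f w) + 2%:R * (g s * eta s)).
lra.
Unshelve. all: by end_near. Qed.

Lemma D_g w : N (w - z0) < r -> f w != 0 -> N (f w) <= 1000^-1 ->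
  Dc g w (dquintic (f w) * p w / (2%:R * g w)).
Proof.
move=> hw f0 f1.
apply: (D_sqrt (Q := fun s => quintic (f s))).
- have cp := p_cont hw.
  have cp2 : {for w, continuous (fun s => p s ^+ 2)} by exact: (contM cp cp).
  exact: contD (contM (cont_cst (9%:R / 8%:R)) cp2)
    (contM (cont_cst L) (contB (f_cont hw) (cont_cst 1))).
- by rewrite -sqrf_eq0 ode // quintic_neq0.
- by apply: filterS (near_ball hw) => s /ode.
- exact: (D_comp (cont_id w) (D_quintic (f w)) (Df hw)).
Qed.

Lemma simple_zero_absurd : L != 0 -> f z0 = 0 -> False.
Proof.
move=> L0 fz0.
have hz0 : N (z0 - z0) < r by rewrite subrr N0.
pose a := p z0.
(* At [z0] the equation reads [(9/8 a^2 - L)^2 = 0]. *)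
have a0 : a != 0.
  apply/eqP => a0; have := ode hz0.
  rewrite /g fz0 -/a a0 /quintic mul0r mul0r expr0n mulr0 add0r sub0r mulrN1 sqrrN.
  by move/eqP; rewrite sqrf_eq0 (negbTE L0).
have Na : 0 < N a by rewrite N_gt0.
have [phi [Hphi cphi phi0]] := Df hz0.
have ea : 0 < 100^-1 * N a by rewrite mulr_gt0.
(* On this disc both the slope [phi] of [f] from [z0] and the derivative [p] are within one percent
   of [a]. *)
have /near_C [d d0 hd] : \forall w \near z0, [/\ N (w - z0) < r,
    f w = phi w * (w - z0), N (phi w - a) < 100^-1 * N a,
    N (p w - a) < 100^-1 * N a & N (f w) < 1000^-1].
  have h1 := near_ball hz0.
  have h2 := (cont_C _ _).1 cphi _ ea; rewrite phi0 -/a in h2.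
  have h3 := (cont_C _ _).1 (p_cont hz0) _ ea; rewrite -/a in h3.
  have h4 := (cont_C _ _).1 (f_cont hz0) 1000^-1 ltac:(lra).
  rewrite fz0 in Hphi h4.
  near=> w; split.
  - by near: w.
  - by rewrite -[LHS]subr0; near: w.
  - by near: w.
  - by near: w.
  - by rewrite -[f w]subr0; near: w.
pose q := circle z0 (d / 2)%:C%C.
have Nq t : N (q t - z0) = d / 2 by rewrite N_circle N_real gtr0_norm; lra.
have q_ok t : [/\ N (q t - z0) < r, f (q t) = phi (q t) * (q t - z0),
    N (phi (q t) - a) < 100^-1 * N a, N (p (q t) - a) < 100^-1 * N a & N (f (q t)) < 1000^-1].
  by apply: hd; rewrite Nq; lra.
have phi_ge t : 99 / 100 * N a < N (phi (q t)).
  by have [_ _ h _ _] := q_ok t; have := N_sub_ge (phi (q t)) a; lra.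
have fq0 t : f (q t) != 0.
  have [_ -> _ _ _] := q_ok t; rewrite mulf_neq0 // -N_gt0 ?Nq; last lra.
  by have := phi_ge t; lra.
have kq0 t : quintic (f (q t)) != 0.
  by have [_ _ _ _ h] := q_ok t; apply: quintic_neq0 => //; exact: ltW.
pose l t := dquintic (f (q t)) * p (q t) / (2%:R * g (q t)) * ('i%C * (q t - z0)).
have : g (q 0) = 0.
  apply: (@winding R (1 / 2) (fun t => g (q t)) l).
  - move=> t _; have [h _ _ _ h'] := q_ok t.
    apply: D_comp (D_circle _ _ _); first exact: cont_real.
    by apply: D_g => //; exact: ltW.
  - move=> t _; have [h1 h2 h3 h4 h5] := q_ok t.
    have g2 := ode h1.
    have gn0 : g (q t) != 0 by rewrite -sqrf_eq0 g2.
    have phin0 : phi (q t) != 0 by rewrite -N_gt0; have := phi_ge t; lra.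
    (* Substitute [q t - z0 = f / phi] in [l] and write [g] as [quintic f / g]. One error term
       measures f k' - k, the other the gap between [p] and [phi]. *)
    have -> : l t - 'i%C * (1 / 2)%:C%C * g (q t) = 'i%C / (2%:R * g (q t)) *
       ((f (q t) * dquintic (f (q t)) - quintic (f (q t))) * (p (q t) / phi (q t))
        + quintic (f (q t)) * ((p (q t) - phi (q t)) / phi (q t))).
      rewrite -g2 /l {2}h2 fmorph_div rmorph_nat rmorph1.
      by field; rewrite gn0 phin0.
    have b1 : N (p (q t) - phi (q t)) <= 2 / 100 * N a.
      rewrite -(subrK a (p (q t))) -addrA; apply: le_trans (ND _ _) _.
      rewrite [N (a - _)]NB; lra.
    have phig := phi_ge t.
    have Nphi : 0 < N (phi (q t)) by rewrite N_gt0.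
    have b2 : N ((p (q t) - phi (q t)) / phi (q t)) <= 40^-1.
      by rewrite NM NV ler_pdivrMr //; lra.
    have b3 : N (p (q t) / phi (q t)) <= 2.
      rewrite NM NV ler_pdivrMr //.
      by have := ND (p (q t) - phi (q t)) (phi (q t)); rewrite subrK; lra.
    have b4 := quintic_log_derivative (ltW h5).
    have Ng : 0 < N (g (q t)) by rewrite N_gt0.
    have Nk : N (quintic (f (q t))) = N (g (q t)) * N (g (q t)) by rewrite -g2 NX expr2.
    (* Dividing by [2 * N g], with [N (quintic f) = N g ^+ 2], turns the factor 1/10 into the 1/20
       required by [winding]. *)
    have b5 : N ((f (q t) * dquintic (f (q t)) - quintic (f (q t))) * (p (q t) / phi (q t))
        + quintic (f (q t)) * ((p (q t) - phi (q t)) / phi (q t))) <= 10^-1 * N (quintic (f (q t))).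
      apply: le_trans (ND _ _) _; rewrite !(NM _ (_ / _)).
      have c1 := ler_pM (N_ge0 _) (N_ge0 _) b4 b3.
      have c2 := ler_wpM2l (N_ge0 (quintic (f (q t)))) b2.
      by have := N_ge0 (quintic (f (q t))); lra.
    rewrite NM NM NV NM N_i N_nat mul1r mulrC ler_pdivrMr; last lra.
    by rewrite Nk in b5; lra.
  - by rewrite /q circle0 circle_2pi.
  - exact: cos_half_turn.
move=> g0; have [h _ _ _ _] := q_ok 0.
by have := kq0 0; rewrite -(ode h) g0 expr0n eqxx.
Unshelve. all: by end_near. Qed.

(** * The case [L = 0], where the derivative vanishes at each zero *)

Section multiple_zero.
Hypothesis L0 : L = 0.

Lemma gE w : g w = 9%:R / 8%:R * p w ^+ 2.
Proof. by rewrite /g L0 mul0r addr0. Qed.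

Let u w := f w / p w.

Lemma p_neq0 w : N (w - z0) < r -> f w != 0 -> N (f w) <= 1000^-1 -> p w != 0.
Proof.
move=> hw f0 f1; apply/eqP => pw0; have := quintic_neq0 f0 f1.
by rewrite -ode // gE pw0 expr0n mulr0 expr0n eqxx.
Qed.

(** Here [81/64 * p ^+ 4 = quintic f], so [p] is a continuous fourth root and p'/p is a quarter of
    the logarithmic derivative of [quintic f]. *)
Lemma D_u w : N (w - z0) < r -> f w != 0 -> N (f w) <= 1000^-1 ->
  Dc u w (1 - 4%:R^-1 * (f w * dquintic (f w) / quintic (f w))).
Proof.
move=> hw f0 f1; have pn0 := p_neq0 hw f0 f1; have ci := cont_id w.
have Dp : Dc p w (8%:R / 9%:R * (dquintic (f w) * p w / (2%:R * g w)) / (2%:R * p w)).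
  apply: (D_sqrt (Q := fun s => 8%:R / 9%:R * g s)).
  - exact: p_cont.
  - exact: pn0.
  - by near=> s; rewrite gE; field.
  - exact: (D_scale ci _ (D_g hw f0 f1)).
apply: D_eq (D_mul ci (Df hw) (D_inv ci Dp pn0)) _.
rewrite -ode // gE; field; exact: pn0.
Unshelve. all: by end_near. Qed.

Lemma N_Du w : f w != 0 -> N (f w) <= 1000^-1 ->
  N (1 - 4%:R^-1 * (f w * dquintic (f w) / quintic (f w)) - 3%:R / 4%:R) <= 400^-1.
Proof.
move=> f0 f1; have kn0 := quintic_neq0 f0 f1.
have -> : 1 - 4%:R^-1 * (f w * dquintic (f w) / quintic (f w)) - 3%:R / 4%:R =
  - 4%:R^-1 * ((f w * dquintic (f w) - quintic (f w)) / quintic (f w)) by field; exact: kn0.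
have Nk : 0 < N (quintic (f w)) by rewrite N_gt0.
have h : N ((f w * dquintic (f w) - quintic (f w)) / quintic (f w)) <= 100^-1.
  by rewrite NM NV ler_pdivrMr //; exact: quintic_log_derivative.
by rewrite NM NN NV N_nat; lra.
Qed.

(** The equation gives u^4 = (81/64) f^3 / v^2, and [N v] is at least 2. This serves in both
    directions: [u] is small where [f] is, and a lower bound on [u] keeps [f] away from 0. *)
Lemma N_u_le w : N (w - z0) < r -> f w != 0 -> N (f w) <= 1000^-1 ->
  N (u w) ^+ 4 <= N (f w) ^+ 3.
Proof.
move=> hw f0 f1; have pn0 := p_neq0 hw f0 f1.
have [h1 h2] := factors_ge f1.
pose v := (f w - 1) * (4%:R * f w - 3%:R).
have hv : 2 <= N v.
  have : 999 / 1000 * (2996 / 1000) <= N v.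
    by rewrite [N v]NM; apply: ler_pM h1 h2; lra.
  by move: (N v) => nv ?; lra.
have E : 64%:R * (u w ^+ 4 * v ^+ 2) = 81%:R * f w ^+ 3.
  have e := ode hw; rewrite gE in e.
  have -> : u w ^+ 4 * v ^+ 2 = f w ^+ 3 / p w ^+ 4 * quintic (f w).
    by rewrite /u /v /quintic; field; exact: pn0.
  by rewrite -e; field; exact: pn0.
have EN : 64 * (N (u w) ^+ 4 * N v ^+ 2) = 81 * N (f w) ^+ 3.
  by rewrite -!NX -[64]N_nat -[81]N_nat -!NM E.
have hv2 : 4 <= N v ^+ 2 by rewrite expr2; nra.
have u4 : 0 <= N (u w) ^+ 4 by rewrite exprn_ge0 // N_ge0.
move: EN hv2 u4; move: (N (u w) ^+ 4) (N v ^+ 2) (N (f w) ^+ 3) => a b c *; nra.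
Qed.

(** The choice of [w0] makes the left-hand difference vanish at the starting point [z1]. Its
    derivative along the circle is at most [N w0 / 400], over a time of at most 8. Nonvanishing is
    assumed only up to time [s], so that the estimate can be used before a possible first zero. *)
Lemma circle_estimate (z1 : C) (s : R) :
  let w0 := 4%:R / 3%:R * u z1 in
  let q := circle (z1 - w0) w0 in
  0 <= s <= 2 * pi ->
  (forall t : R, 0 <= t <= s -> N (q t - z0) < r /\ N (f (q t)) <= 1000^-1) ->
  (forall t : R, 0 <= t <= s -> f (q t) != 0) ->
  N (u (q s) - 3%:R / 4%:R * (q s - (z1 - w0))) <= 50^-1 * N w0.
Proof.
move=> w0 q /andP[s0 sT] hq fq.
pose dU t := (1 - 4%:R^-1 * (f (q t) * dquintic (f (q t)) / quintic (f (q t))) - 3%:R / 4%:R)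
  * ('i%C * (q t - (z1 - w0))).
have DU t : 0 <= t <= s -> Dr (fun t => u (q t) + - (3%:R / 4%:R) * q t) t (dU t).
  move=> ht; have [h1 h2] := hq _ ht; have ct := @cont_real R t.
  have Dq := D_circle (z1 - w0) w0 t.
  have Duq : Dr (fun t => u (q t)) t _ := D_comp ct (D_u h1 (fq _ ht) h2) Dq.
  have H := D_add Duq (D_scale ct (- (3%:R / 4%:R)) Dq).
  apply: D_eq H _.
  by rewrite /dU /q; ring.
have hU t : 0 <= t <= s -> N (dU t) <= 400^-1 * N w0.
  move=> ht; have [h1 h2] := hq _ ht.
  rewrite NM [N ('i%C * _)]NM N_i mul1r N_circle ler_wpM2r ?N_ge0 //.
  by apply: N_Du => //; exact: fq.
have := N_mvt s0 DU hU.
have -> : u (q s) + - (3%:R / 4%:R) * q s - (u (q 0) + - (3%:R / 4%:R) * q 0) =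
    u (q s) - 3%:R / 4%:R * (q s - (z1 - w0)).
  by rewrite /q circle0 subrK /w0; field.
move=> h; apply: le_trans h _.
have s8 : s <= 8 by have := @pi_le4 R; lra.
have := ler_wpM2l (N_ge0 w0) s8; move: (N w0) => n; lra.
Qed.

Lemma zero_near_multiple_zero : f z0 = 0 -> exists2 d : R, 0 < d &
  forall w, N (w - z0) < d -> f w = 0.
Proof.
move=> fz0; have hz0 : N (z0 - z0) < r by rewrite subrr N0.
have cf0 := f_cont hz0.
have /near_C [d0 d0_gt0 hd0] : \forall w \near z0, N (w - z0) < r /\ N (f w) <= 1000^-1.
  have h4 := (cont_C _ _).1 cf0 1000^-1 ltac:(lra).
  rewrite fz0 in h4.
  have h1 := near_ball hz0.
  near=> w; split; first by near: w.
  by apply: ltW; rewrite -[f w]subr0; near: w.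
(* By [N_u_le], [N (f z1) ^+ 3 < m] forces [N (u z1) < d0 / 8]. The circle, of radius 4/3 of that,
   then stays within [d0] of [z0]. *)
pose m := (d0 / 8) ^+ 4.
have m0 : 0 < m by rewrite exprn_gt0 //; lra.
have /near_C [d1 d1_gt0 hd1] : \forall w \near z0, N (f w) ^+ 3 < m.
  have cf3 : {for z0, continuous (fun w => f w * (f w * f w))}.
    exact: (contM cf0 (contM cf0 cf0)).
  have h := (cont_C _ _).1 cf3 _ m0; rewrite fz0 mul0r in h.
  near=> w; rewrite -NX -[f w ^+ 3]subr0; near: w; exact: h.
exists (Num.min (d0 / 8) d1); first by rewrite lt_min d1_gt0 andbT; lra.
move=> z1; rewrite lt_min => /andP[z1d0 z1d1].
have [//|f1] := eqVneq (f z1) 0; exfalso.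
have [z1r z1small] := hd0 z1 ltac:(lra).
pose w0 := 4%:R / 3%:R * u z1; pose q := circle (z1 - w0) w0.
have p1 := p_neq0 z1r f1 z1small.
have u1 : 0 < N (u z1) by rewrite N_gt0 mulf_neq0 // invr_eq0.
have u1d : N (u z1) < d0 / 8.
  rewrite -(@ltr_pXn2r _ 4) ?nnegrE ?N_ge0 //; last by lra.
  exact: le_lt_trans (N_u_le z1r f1 z1small) (hd1 _ z1d1).
have Nw0 : N w0 = 4 / 3 * N (u z1) by rewrite /w0 !NM NV !N_nat.
have hq t : N (q t - z0) < r /\ N (f (q t)) <= 1000^-1.
  apply: hd0.
  have -> : q t - z0 = (q t - (z1 - w0)) - w0 + (z1 - z0) by ring.
  apply: le_lt_trans (ND _ _) _.
  have := ND (q t - (z1 - w0)) (- w0); rewrite N_circle NN Nw0.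
  move: (N (_ - w0)) (N (z1 - z0)) z1d0 => a b; lra.
have hc t : N (3%:R / 4%:R * (q t - (z1 - w0))) = 3 / 4 * N w0.
  by rewrite NM N_circle NM NV !N_nat.
(* The main term has modulus [3/4 N w0] and the error is at most [1/50 N w0]. *)
have u_ge (s : R) : 0 <= s <= 2 * pi -> (forall t : R, 0 <= t <= s -> f (q t) != 0) ->
    7 / 10 * N w0 <= N (u (q s)).
  move=> hs fq; have h := circle_estimate hs (fun t _ => hq t) fq.
  have := N_sub_ge (u (q s)) (3%:R / 4%:R * (q s - (z1 - w0))).
  rewrite hc; move: h; rewrite -/w0 -/q.
  move: (N (_ - _)) (N w0) (N (u (q s))) (N_ge0 w0) => a b c; lra.
have cq t : {for t, continuous (fun t => f (q t))}.
  have [h _] := hq t.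
  exact: continuous_comp (D_cont (@cont_real R t) (D_circle _ _ t)) (f_cont h).
(* Before a first zero [t1] the bound [u_ge] holds, so [N f ^+ 3 >= N u ^+ 4] stays above the
   positive constant [e], against continuity of [f] along the circle at [t1]. *)
have fq0 t : 0 <= t <= 2 * pi -> f (q t) != 0.
  move=> ht; apply/eqP => ft.
  have [t1 [t1T ft1 before]] := first_zero (fun t _ => cq t) (ex_intro2 _ _ t ht ft).
  have t1_gt0 : 0 < t1.
    have /andP[] := t1T; rewrite le_eqVlt => /orP[/eqP t10|//] _.
    by move: ft1; rewrite -t10 /q circle0 subrK => /eqP; rewrite (negbTE f1).
  pose e := (7 / 10 * N w0) ^+ 4.
  have e0 : 0 < e by rewrite exprn_gt0 // Nw0; move: (N (u z1)) u1 => a; lra.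
  have cq3 : {for t1, continuous (fun t => f (q t) * (f (q t) * f (q t)))}.
    exact: (contM (cq t1) (contM (cq t1) (cq t1))).
  have := (cont_C _ _).1 cq3 _ e0; rewrite ft1 mul0r => /near_R [d d_gt0 hd].
  (* A time before [t1], within [d] of it and still in the parameter interval. *)
  pose s := Num.max 0 (t1 - d / 2).
  have s0 : 0 <= s by rewrite le_max lexx.
  have st : s < t1 by rewrite gt_max t1_gt0 /=; lra.
  have sd : t1 - d / 2 <= s by rewrite le_max lexx orbT.
  have := hd s; rewrite distrC gtr0_norm ?subr_gt0 // subr0 => /(_ ltac:(lra)).
  apply/negP; rewrite -leNgt.
  have sT : 0 <= s <= 2 * pi by move/andP: t1T => [_ ?]; lra.
  have fs t' : 0 <= t' <= s -> f (q t') != 0 by move=> /andP[? ?]; apply: before; lra.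
  have [h1 h2] := hq s; have fs0 : f (q s) != 0 by apply: fs; rewrite s0 lexx.
  have -> : f (q s) * (f (q s) * f (q s)) = f (q s) ^+ 3 by ring.
  rewrite NX; apply: le_trans (N_u_le h1 fs0 h2).
  rewrite /e lerXn2r ?nnegrE ?N_ge0 //; last exact: u_ge.
  by rewrite mulr_ge0 ?N_ge0 //; lra.
pose l t := p (q t) * ('i%C * (q t - (z1 - w0))).
have : f (q 0) = 0.
  apply: (@winding R (4 / 3) (fun t => f (q t)) l).
  - move=> t _; have [h _] := hq t.
    exact: (D_comp (@cont_real R t) (Df h) (D_circle _ _ t)).
  - move=> t ht; have [h1 h2] := hq t.
    have fs t' : 0 <= t' <= t -> f (q t') != 0.
      by move=> /andP[? ?]; move/andP: ht => [? ?]; apply: fq0; lra.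
    have pn := p_neq0 h1 (fq0 _ ht) h2.
    have fE : f (q t) = u (q t) * p (q t) by rewrite /u divfK.
    have -> : l t - 'i%C * (4 / 3)%:C%C * f (q t) =
        - (4%:R / 3%:R) * 'i%C * p (q t) *
          (u (q t) - 3%:R / 4%:R * (q t - (z1 - w0))).
      by rewrite fE /l fmorph_div !rmorph_nat; field.
    have b1 := circle_estimate ht (fun t _ => hq t) fs.
    have b2 := u_ge _ ht fs.
    have NR : N (- (4%:R / 3%:R) * 'i%C : C) = 4 / 3.
      by rewrite NM NN N_i mulr1 NM NV !N_nat.
    have EN (P X : C) : N (- (4%:R / 3%:R) * 'i%C * P * X) = 4 / 3 * N P * N X.
      by rewrite NM NM NR.
    rewrite EN fE (NM (u (q t))).
    (* It suffices that [4/3 * 1/50 <= 1/20 * 7/10]. *)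
    have b3 : 4 / 3 * N (u (q t) - 3%:R / 4%:R * (q t - (z1 - w0))) <= 20^-1 * N (u (q t)).
      move: b1 b2 (N_ge0 w0); rewrite -/w0 -/q.
      by move: (N (_ - _)) (N w0) (N (u (q t))) => a b c; lra.
    rewrite mulrAC mulrA; exact: ler_wpM2r (N_ge0 (p (q t))) _ _ b3.
  - by rewrite /q circle0 circle_2pi.
  - exact: cos_four_thirds_turn.
by rewrite /q circle0 subrK => /eqP; rewrite (negbTE f1).
Unshelve. all: by end_near. Qed.

End multiple_zero.

End ode.
End local_analysis.

(** * Zeros on the whole domain *)

Section global.
Variable R : realType.
Local Notation C := (R[i]^o).

Lemma near_punctured (z : C) (P : set C) :
  (\forall w \near z^', P w) -> P z -> \forall w \near z, P w.
Proof.
move=> /near_C [d d0 H] Pz; apply/near_C; exists d => // w hw.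
by have [->//|wz] := eqVneq w z; apply: H.
Qed.

Lemma clopen_subset_eq (D A : set C) : connected D -> A `<=` D -> A !=set0 ->
  (forall w, A w -> \forall s \near w, A s) ->
  (forall w, D w -> ~ A w -> \forall s \near w, D s /\ ~ A s) -> A = D.
Proof.
move=> cD AD A0 oA oDA; apply: cD => //.
  exists A; last by rewrite setIidr.
  by rewrite openE => w /oA.
(* For relative closedness, [A] is the trace on [D] of the complement of the open set of points of
   [D] outside [A]. *)
exists (~` [set w | D w /\ ~ A w]).
  by apply: open_closedC; rewrite openE => w [Dw Aw]; exact: oDA.
apply/seteqP; split => [w Aw|w [Dw]] /=; first by split; [exact: AD | case].
by move=> h; apply: contrapT => Aw; apply: h.
Qed.
End global.

Theorem theorem9 (R : realType) (lambda : R) (D P : set R[i]^o) (f : R[i]^o -> R[i]^o) :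
  0 < lambda < 1 ->
  open D -> connected D ->
  meromorphic_on D P f ->
  ~ (exists c : R[i]^o, forall z, D z -> ~ P z -> f z = c) ->
  (forall z, D z -> ~ P z ->
     (9%:R / 8%:R * ('D_1 f z) ^+ 2 + ((1 - 2%:R * lambda ^+ 2)%:C)%C * (f z - 1)) ^+ 2
     = f z * (f z - 1) ^+ 2 * (4%:R * f z - 3%:R) ^+ 2) ->
  forall z, D z -> ~ P z -> f z != 0.
Proof.
move=> _ oD cD [PD Pdiscrete fdiff fpole] fnc ode z Dz Pz.
apply/eqP => fz; apply: fnc; exists 0.
have regular w : D w -> ~ P w -> \forall s \near w, D s /\ ~ P s.
  move=> Dw Pw; have h1 := open_nbhs_nbhs (conj oD Dw).
  have h2 := near_punctured (Pdiscrete w Dw) Pw.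
  by near=> s; split; near: s.
have zero_near w : D w -> ~ P w -> f w = 0 -> \forall s \near w, f s = 0.
  move=> Dw Pw fw; have [r r0 hr] := (near_C _ _).1 (regular w Dw Pw).
  have Df s : N (s - w) < r -> deriv_along (id : R[i]^o -> R[i]^o) f s ('D_1 f s).
    by move=> /hr [Ds Ps]; apply: D_derivable; exact: fdiff.
  have ode' s (h : N (s - w) < r) := ode s (hr s h).1 (hr s h).2.
  have [L0|L0] := eqVneq ((1 - 2%:R * lambda ^+ 2)%:C%C : R[i]^o) 0.
    have [d d0 hd] := zero_near_multiple_zero r0 Df ode' L0 fw.
    by apply/near_C; exists d.
  by have := simple_zero_absurd r0 Df ode' L0 fw.
(* Poles are counted in the complement of the zero set, so connectedness of [D] itself suffices; the
   resulting equality says that [f] is 0 throughout [D]. *)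
have <- : [set w | [/\ D w, ~ P w & f w = 0]] = D.
  apply: clopen_subset_eq => //; first by move=> w [].
  - by exists z.
  - move=> w [Dw Pw fw]; have h1 := regular w Dw Pw; have h2 := zero_near w Dw Pw fw.
    near=> s; have [? ?] : D s /\ ~ P s by near: s.
    by split => //; near: s.
  - move=> w Dw Aw; have h1 := open_nbhs_nbhs (conj oD Dw).
    have h2 : \forall s \near w, ~ [/\ D s, ~ P s & f s = 0].
      have [Pw|Pw] := pselect (P w).
        (* Near a pole the modulus of [f] is at least 1, so no zero is close to it. *)
        apply: near_punctured Aw; have := fpole w Pw 1.
        apply: filterS => s h [_ _ fs]; move: h.
        by rewrite fs normr0 lecR ler10.
      have fw : f w != 0 by apply/eqP => fw; apply: Aw.
      have cf := D_cont (cont_id w) (D_derivable (fdiff w Dw Pw)).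
      by apply: filterS (cont_neq0 cf fw) => s /eqP fs [].
    by near=> s; split; near: s.
by move=> w [].
Unshelve. all: by end_near. Qed.
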